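(* Let $G$ be a graph on $n$ vertices and let $r$ be a real number with $0<r\le 1/2$. (i) If $\mu_2\ge r\mu_n$, then $\alpha'_f(G)\ge rn$. (ii) If $\mu_2\ge r\mu_n$ and $\alpha'(G)\ne\frac12(n-1)$, then $\alpha'(G)\ge rn$.
   Context: All graphs are finite, simple and nonempty. $\mu_1\le\mu_2\le\cdots\le\mu_n$ are the eigenvalues of the Laplacian matrix $L=D-A$ of $G$ ($D$ the diagonal degree matrix, $A$ the adjacency matrix). $\alpha'(G)$ is the matching number. A fractional matching is a function $f:E(G)\to[0,1]$ with $\sum_{e\ni v}f(e)\le1$ for all vertices $v$; the fractional matching number $\alpha'_f(G)$ is the maximum of $\sum_{e\in E(G)}f(e)$ over fractional matchings. *)

(* Defs.v *)
From HB Require Import structures.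
From mathcomp Require Import all_boot all_order all_algebra.
From mathcomp Require Import polyrcf complex.
From mathcomp Require Import all_classical all_reals all_analysis.

Set Implicit Arguments.
Unset Strict Implicit.
Unset Printing Implicit Defensive.

Import Order.TTheory GRing.Theory Num.Theory numFieldNormedType.Exports.
Local Open Scope ring_scope.

Record sgraph := SGraph {
  vertex :> finType;
  adj : rel vertex;
  adj_sym : symmetric adj;
  adj_irr : irreflexive adj }.

Definition edges (G : sgraph) : {set {set G}} :=
  [set [set p.1; p.2]%SET | p in [pred p : G * G | adj p.1 p.2]]%SET.

Definition degree (G : sgraph) (x : G) : nat := #|[pred y | adj x y]|.

Definition is_matching (G : sgraph) (M : {set {set G}}) : bool :=
  (M \subset edges G) && finset.trivIset M.

Definition matching_number (G : sgraph) : nat :=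
  (\max_(M : {set {set G}} | is_matching M) #|M|)%N.

(* Only the values on [edges G] matter; the domain {set G} merely avoids a
   subtype of edges. *)
Definition fractional_matching (R : realType) (G : sgraph)
    (f : {set G} -> R) : Prop :=
  (forall e, e \in edges G -> 0 <= f e <= 1) /\
  (forall x : G, \sum_(e in edges G | x \in e) f e <= 1).

(* The supremum is a maximum: see fractional_matching_number_max. *)
Definition fractional_matching_number (R : realType) (G : sgraph) : R :=
  sup [set \sum_(e in edges G) f e
      | f in [set f | @fractional_matching R G f]]%classic.

Definition adjacency_mx (R : realType) (G : sgraph) : 'M[R]_#|G| :=
  \matrix_(i, j) (adj (enum_val i) (enum_val j))%:R.

Definition degree_mx (R : realType) (G : sgraph) : 'M[R]_#|G| :=
  diag_mx (\row_i (degree (enum_val i))%:R).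

Definition laplacian (R : realType) (G : sgraph) : 'M[R]_#|G| :=
  degree_mx R G - adjacency_mx R G.

(* [rootsR p] lists the distinct roots of p in increasing order; each is
   repeated according to its algebraic multiplicity. *)
Definition eigenvalues (R : realType) (n : nat) (A : 'M[R]_n) : seq R :=
  flatten [seq nseq (mup x (char_poly A)) x | x <- rootsR (char_poly A)].

(* [laplacian_eigenvalue R G k] is mu_k for 1 <= k <= #|G|. *)
Definition laplacian_eigenvalue (R : realType) (G : sgraph) (k : nat) : R :=
  nth 0 (eigenvalues (laplacian R G)) k.-1.

Lemma eigenvalues_sorted (R : realType) (n : nat) (A : 'M[R]_n) :
  sorted <=%R (eigenvalues A).
Proof.
rewrite /eigenvalues; set p := char_poly A.
have : sorted <%R (rootsR p) by exact: sorted_roots.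
elim: (rootsR p) => [//|x s IHs] /= xs.
have s_sorted := path_sorted xs.
have xlt : all (<%R x) s by move: xs; rewrite lt_path_sortedE => /andP[].
rewrite (sorted_pairwise le_trans) pairwise_cat.
rewrite -!(sorted_pairwise le_trans) IHs // andbT; apply/andP; split.
  apply/allrelP => a b /nseqP[-> _] /flattenP[_ /mapP[y ys ->] /nseqP[-> _]].
  by rewrite ltW // (allP xlt).
by elim: (mup x p) => [//|k IHk] /=; case: k IHk => //= k ->; rewrite lexx.
Qed.

Lemma symmetric_eigenvalues (R : realType) (n : nat) (A : 'M[R]_n) :
  A^T = A -> char_poly A = \prod_(x <- eigenvalues A) ('X - x%:P).
Proof.
move=> symA; pose f := real_complex R.
have [s ps] : exists s, char_poly A = \prod_(x <- s) ('X - x%:P).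
  pose B := map_mx f A.
  have hB : B \is hermsymmx.
    apply: realsym_hermsym.
      by apply/is_hermitianmxP; rewrite expr0 scale1r map_mx_id // map_trmx symA.
    by apply/mxOverP => i j; rewrite mxE complex_real.
  have /hermitian_normalmx /orthomx_spectralP eB := hB.
  have /mxOverP rB := hermitian_spectral_diag_real hB.
  pose s := [seq complex.Re (spectral_diag B 0 i) | i <- enum 'I_n].
  exists s; apply: (map_poly_inj f).
  rewrite map_char_poly -/B {1}eB rmorph_prod big_map big_enum /=.
  set P := spectralmx B; set D := spectral_diag B.
  have Pu : P \in unitmx by exact: spectral_unit.
  transitivity (char_poly (diag_mx D)).
    pose Q := map_mx (@polyC _) P; pose Q' := map_mx (@polyC _) (invmx P).
    have Q'Q : Q' *m Q = 1%:M by rewrite -map_mxM mulVmx // map_mx1.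
    rewrite /char_poly /char_poly_mx !map_mxM.
    have {1}-> : 'X%:M = Q' *m 'X%:M *m Q :> 'M[{poly R[i]}]_n.
      by rewrite scalar_mxC -mulmxA Q'Q mulmx1.
    rewrite -mulmxBl -mulmxBr !det_mulmx mulrAC -det_mulmx Q'Q det1 mul1r.
    by [].
  rewrite char_poly_trig ?diag_mx_is_trig //; apply: eq_bigr => i _.
  rewrite rmorphB /= map_polyX map_polyC /= mxE eqxx mulr1n.
  by congr ('X - _%:P); rewrite -[LHS]RRe_real ?rB.
rewrite [LHS]ps; apply: perm_big; apply/allP => /= x _.
rewrite /eigenvalues; set p := char_poly A.
have p0 : p != 0 by rewrite monic_neq0 // char_poly_monic.
have -> : count_mem x s = mup x p by rewrite /p ps mu_prod_XsubC.
have ru : uniq (rootsR p) by apply: (sorted_uniq lt_trans ltxx); exact: sorted_roots.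
have cf (t : seq R) : uniq t ->
    count_mem x (flatten [seq nseq (mup y p) y | y <- t]) = ((x \in t) * mup x p)%N.
  elim: t => [//|y t IHt] /= /andP[yt ut].
  rewrite count_cat IHt // inE count_nseq /= eq_sym.
  case: (eqVneq x y) => [->|_] /=; last by rewrite mul0n.
  by rewrite (negbTE yt) !mul1n mul0n addn0.
rewrite cf // -(roots_on_rootsR p0) in_itv /=.
by case: (boolP (root p x)) => [_|/mupNroot ->]; rewrite ?mul1n ?muln0.
Qed.

Lemma laplacian_sym (R : realType) (G : sgraph) :
  (laplacian R G)^T = laplacian R G.
Proof.
apply/matrixP => i j; rewrite !mxE [j == i]eq_sym adj_sym.
by case: eqVneq => [->|].
Qed.

Lemma size_laplacian_eigenvalues (R : realType) (G : sgraph) :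
  size (eigenvalues (laplacian R G)) = #|G|.
Proof.
have := size_char_poly (laplacian R G).
by rewrite symmetric_eigenvalues ?laplacian_sym // size_prod_XsubC => -[].
Qed.

Lemma fractional_matching_number_max (R : realType) (G : sgraph) :
  exists2 f, @fractional_matching R G f &
    \sum_(e in edges G) f e = fractional_matching_number R G.
Proof.
pose ev (e : {set G}) (v : 'rV[R]_#|{set G}|) : R := v 0 (enum_rank e).
have evc e : continuous (ev e) by exact: coord_continuous.
have sumc (Q : pred {set G}) : continuous (fun v => \sum_(e | Q e) ev e v).
  by apply: continuous_big => [|e _]; [exact: add_continuous|exact: evc].
pose A : set 'rV[R]_#|{set G}| :=
  ([set v : 'rV[R]_#|{set G}| | forall i, `[0, 1]%classic (v ord0 i)] `&`
   \bigcap_x [set v | \sum_(e in edges G | x \in e) ev e v <= 1])%classic.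
have cA : compact A.
  apply: compact_closedI; first exact: (rV_compact (fun=> @segment_compact R 0 1)).
  apply: closed_bigI => x _.
  by apply: (@preimage_closed _ _ (fun v => \sum_(e in edges G | x \in e) ev e v)
    [set y : R | y <= 1]%classic); [move=> v _; exact: sumc|exact: closed_le].
have A0 : (A !=set0)%classic.
  exists 0; split=> [i|x _] /=; first by rewrite mxE in_itv /= lexx ler01.
  by rewrite big1 ?ler01 // => e _; rewrite /ev mxE.
have [c /set_mem[/= c01 c1] cmax] :=
  compact_EVT_max A0 cA (continuous_subspaceT (sumc (mem (edges G)))).
have fc : @fractional_matching R G (ev^~ c).
  split=> [e _|x]; last exact: c1.
  by have := c01 (enum_rank e); rewrite in_itv.
have cub (g : {set G} -> R) : @fractional_matching R G g ->
    \sum_(e in edges G) g e <= \sum_(e in edges G) ev e c.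
  move=> [g01 g1].
  pose w : 'rV[R]_#|{set G}| :=
    \row_i (if enum_val i \in edges G then g (enum_val i) else 0).
  have wE e : e \in edges G -> ev e w = g e.
    by move=> eE; rewrite /ev mxE enum_rankK eE.
  rewrite -(eq_bigr _ wE); apply: cmax; apply/mem_set; split=> [i|x _] /=.
    by rewrite mxE in_itv /=; case: ifP => [/g01//|_]; rewrite lexx ler01.
  by rewrite (eq_bigr g) ?g1 // => e /andP[/wE].
exists (ev^~ c) => //; apply/eqP; rewrite eq_le; apply/andP; split.
  apply: ub_le_sup; last by exists (ev^~ c).
  by exists (\sum_(e in edges G) ev e c) => _ [g fg <-]; exact: cub.
apply: ge_sup; first by exists (\sum_(e in edges G) ev e c), (ev^~ c).
by move=> _ [g fg <-]; exact: cub.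
Qed.

(* Main.v *)
Require Import Defs.
From mathcomp Require Import all_boot all_order all_algebra.
From mathcomp Require Import complex ring lra zify.
From mathcomp Require Import all_classical all_reals all_analysis.
From mathcomp Require Import fintype finset.

Import Order.TTheory GRing.Theory Num.Theory.
Local Open Scope ring_scope.

(** By the Tutte-Berge formula there are a set [S] of [s] vertices and a family
    of at least [s + d] pairwise nonadjacent parts of the complement of [S],
    where [d] is the number of vertices missed by a maximum matching.
    If there are at least two parts and [d >= 1], then Rayleigh quotients bound
    the sum of the edge cuts of the parts from below in terms of [mu_2] (test
    vectors supported on one or two parts), while this sum is the edge cut of
    [S], bounded above in terms of [mu_n]; comparing both gives
    [2 r n <= n - d], i.e. [r n] is at most the matching number.
    The formula is proved by Gallai's argument: vertices covered by every
    maximum matching are moved into [S]; when none is left, "no maximum matching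
    misses both" is an equivalence relation whose classes are the parts.
    In the exceptional case [d = 1], either some vertex is covered by every
    maximum matching, so that [S] is nonempty and there are two parts, or each
    vertex is missed by a near-perfect matching, and averaging these matchings
    gives a fractional perfect matching. *)

(** * Rayleigh quotients of symmetric matrices *)

Lemma char_poly_conj {F : comNzRingType} {n : nat} (P Q A : 'M[F]_n) :
  Q *m P = 1%:M -> char_poly (Q *m A *m P) = char_poly A.
Proof.
move=> QP; pose f (M : 'M[F]_n) := map_mx (@polyC F) M.
have fQP : f Q *m f P = 1%:M by rewrite -map_mxM QP map_mx1.
rewrite /char_poly /char_poly_mx !map_mxM -/f.
rewrite -[X in X - _]mulmx1 -fQP mulmxA -scalar_mxC -mulmxBl -mulmxBr.
by rewrite !det_mulmx mulrAC -det_mulmx fQP det1 mul1r.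
Qed.

(** [c x i] is the [i]-th coordinate of [x] in a unitary eigenbasis of [A]. It is complex because
    the spectral theorem is applied to the hermitian matrix obtained by extending scalars; the
    eigenvalues [lam i] stay real. *)
Lemma symmetric_spectral {R : realType} {n : nat} (A : 'M[R]_n) :
  A^T = A ->
  exists (c : 'rV[R]_n -> 'I_n -> R[i]) (lam : 'I_n -> R),
    [/\ perm_eq [seq lam i | i <- enum 'I_n] (eigenvalues A),
        forall x y, real_complex R ((x *m y^T) 0 0) = \sum_i c x i * (c y i)^* &
        forall x i, c (x *m A) i = real_complex R (lam i) * c x i].
Proof.
move=> symA; pose f := real_complex R.
pose B := map_mx f A; pose P := spectralmx B; pose D := spectral_diag B.
have hB : B \is hermsymmx.
  apply: realsym_hermsym.
    by apply/is_hermitianmxP; rewrite expr0 scale1r map_mx_id // map_trmx symA.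
  by apply/mxOverP => i j; rewrite mxE complex_real.
have /hermitian_normalmx /orthomx_spectralP eB := hB.
have /mxOverP rB := hermitian_spectral_diag_real hB.
have uP : P \is unitarymx by exact: spectral_unitarymx.
have Pu : P \in unitmx by exact: spectral_unit.
pose lam i := complex.Re (D 0 i).
have lamE i : f (lam i) = D 0 i by rewrite /f RRe_real ?rB.
exists (fun x i => (map_mx f x *m invmx P) 0 i), lam; split.
- apply: prod_XsubC_eq; rewrite -symmetric_eigenvalues // big_map big_enum /=.
  apply/(map_poly_inj f)/esym; rewrite map_char_poly -/B {1}eB rmorph_prod /=.
  rewrite char_poly_conj ?mulVmx // char_poly_trig ?diag_mx_is_trig //.
  apply: eq_bigr => i _; rewrite rmorphB /= map_polyX map_polyC /= mxE eqxx.
  by rewrite mulr1n; congr ('X - _%:P); rewrite -[LHS]lamE.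
- move=> x y.
  transitivity ((map_mx f x *m invmx P *m (map_mx f y *m invmx P)^t*%sesqui) 0 0).
    rewrite invmx_unitary // trmx_mul map_mxM trmxCK mulmxA mulmxKtV //.
    rewrite !mxE rmorph_sum; apply: eq_bigr => i _.
    by rewrite !mxE rmorphM /= conj_Creal // complex_real.
  by rewrite mxE; apply: eq_bigr => i _; rewrite !mxE.
- move=> x i; rewrite map_mxM -/B -mulmxA.
  have -> : B *m invmx P = invmx P *m diag_mx D by rewrite [in LHS]eB mulmxK.
  by rewrite mulmxA mul_mx_diag mxE mulrC -lamE.
Qed.

Lemma rayleigh_le {R : realType} {n : nat} (A : 'M[R]_n) (x : 'rV[R]_n) :
  A^T = A ->
  (x *m A *m x^T) 0 0 <= nth 0 (eigenvalues A) n.-1 * (x *m x^T) 0 0.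
Proof.
move=> symA; have [c [lam [plam cD cA]]] := symmetric_spectral A symA.
rewrite -lecR rmorphM /= !cD mulr_sumr; apply: ler_sum => i _.
rewrite cA -mulrA -normCK ler_wpM2r ?exprn_ge0 // lecR.
have sev : size (eigenvalues A) = n.
  by rewrite -(perm_size plam) size_map size_enum_ord.
have /(nthP 0)[j jn <-] : lam i \in eigenvalues A.
  by rewrite -(perm_mem plam) map_f ?mem_enum.
rewrite sev in jn; case: n => [|n] in A x symA c lam plam cD cA i sev jn *.
  by case: i.
apply: sorted_leq_nth => //; rewrite ?inE ?sev //.
- exact: le_trans.
- exact: eigenvalues_sorted.
Qed.

(** Only the head of a sorted list can lie strictly below the entry of index 1; hence at most one
    eigendirection lies below the second eigenvalue. *)
Lemma count_lt_nth1 {R : realType} (s : seq R) :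
  sorted <=%R s -> (1 < size s)%N -> (count (< nth 0 s 1)%R s <= 1)%N.
Proof.
case: s => [|a [|b s]] //= /andP[_ sb] _.
rewrite ltxx add0n (_ : count _ s = 0%N) ?addn0 ?leq_b1 //.
apply/eqP; rewrite -leqn0 leqNgt -has_count; apply/hasPn => y ys.
by rewrite -leNgt; move: sb; rewrite le_path_sortedE => /andP[/allP->].
Qed.

(** The kernel vector [u] has no coordinate at a positive eigenvalue, so it lies along the single
    direction [k] whose eigenvalue is below the second one. Being orthogonal to [u], [x] has no
    [k]-coordinate. *)
Lemma rayleigh_ge {R : realType} {n : nat} (A : 'M[R]_n) (u x : 'rV[R]_n) :
  A^T = A -> u *m A = 0 -> u != 0 -> x *m u^T = 0 ->
  0 < nth 0 (eigenvalues A) 1 ->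
  nth 0 (eigenvalues A) 1 * (x *m x^T) 0 0 <= (x *m A *m x^T) 0 0.
Proof.
move=> symA uA u0 xu mu0; have [c [lam [plam cD cA]]] := symmetric_spectral A symA.
set mu := nth _ _ _ in mu0 *.
have lt1 i j : lam i < mu -> lam j < mu -> i = j.
  move=> li lj; have : (count (< mu)%R (eigenvalues A) <= 1)%N.
    apply: count_lt_nth1; first exact: eigenvalues_sorted.
    (* With fewer than two eigenvalues [mu] would be the default value 0. *)
    by case: ltnP mu0 => // s1; rewrite /mu nth_default // ltxx.
  rewrite -(permP plam) count_map -size_filter => le1; apply/eqP.
  case: eqVneq le1 => // ij; rewrite leqNgt => /negP[].
  apply: (@uniq_leq_size _ [:: i; j]); first by rewrite /= inE ij.
  by move=> k; rewrite !inE mem_filter mem_enum /= => /orP[]/eqP->; rewrite ?li ?lj.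
have c0 i : c 0 i = 0.
  have /esym/eqP := cD 0 0; rewrite mul0mx mxE rmorph0 psumr_eq0; last first.
    by move=> k _; rewrite -normCK exprn_ge0.
  by move=> /allP/(_ i (mem_index_enum i)); rewrite -normCK expf_eq0 normr_eq0 => /eqP.
have cu i : mu <= lam i -> c u i = 0.
  move=> mui; have := cA u i; rewrite uA c0 => /esym/eqP; rewrite mulf_eq0.
  rewrite -[0](rmorph0 (real_complex R)) (inj_eq (@complexI R)).
  by rewrite gt_eqF ?(lt_le_trans mu0) //= => /eqP.
have /existsP[k /andP[kmu cuk]] : [exists k, (lam k < mu) && (c u k != 0)].
  apply: contraNT u0; rewrite negb_exists => /forallP cu0.
  have := cD u u; rewrite big1 => [|i _]; last first.
    by have := cu0 i; rewrite negb_and -leNgt negbK => /orP[/cu->|/eqP->]; rewrite mul0r.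
  rewrite -[0 in RHS](rmorph0 (real_complex R)) => /complexI/eqP.
  rewrite mxE psumr_eq0 => [/allP uu|i _]; last by rewrite mxE -expr2 sqr_ge0.
  apply/eqP/rowP => i; rewrite mxE; apply/eqP.
  by have := uu i (mem_index_enum i); rewrite mxE mulf_eq0 orbb.
have cxk : c x k = 0.
  have := cD x u; rewrite xu mxE rmorph0 (bigD1 k) //= big1 ?addr0.
    by move=> /esym/eqP; rewrite mulf_eq0 conjC_eq0 (negbTE cuk) orbF => /eqP.
  move=> i ik; rewrite cu ?conjC0 ?mulr0 // leNgt; apply: contra ik => imu.
  by apply/eqP/lt1.
rewrite -lecR rmorphM /= !cD mulr_sumr; apply: ler_sum => i _.
rewrite cA -mulrA -normCK; have [->|ik] := eqVneq i k.
  by rewrite cxk normr0 expr0n !mulr0.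
rewrite ler_wpM2r ?exprn_ge0 // lecR leNgt.
by apply: contra ik => imu; apply/eqP/lt1.
Qed.

(** * Edge cuts and Laplacian eigenvalues *)

(** Pairing the two orientations of each edge gives the usual sum of [(x u - x v) ^+ 2] over edges.
    The oriented form matches the rows of the Laplacian. *)
Definition dirichlet {R : realType} {G : sgraph} (x : G -> R) : R :=
  \sum_u \sum_v (adj u v)%:R * (x u * (x u - x v)).

(** Orienting edges out of [B] counts each boundary edge once. *)
Definition edge_cut (R : realType) {G : sgraph} (B : {set G}) : R :=
  \sum_u \sum_v [&& adj u v, u \in B & v \notin B]%:R.

Lemma sum_enum_val {R : realType} {G : sgraph} (x : G -> R) :
  \sum_(i < #|G|) x (enum_val i) = \sum_u x u.
Proof. by rewrite [RHS](reindex _ (onW_bij _ (enum_val_bij G))). Qed.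

Lemma laplacian_mulE {R : realType} {G : sgraph} (x : G -> R) (i : 'I_#|G|) :
  (laplacian R G *m (\row_j x (enum_val j))^T) i 0 =
  \sum_v (adj (enum_val i) v)%:R * (x (enum_val i) - x v).
Proof.
rewrite mxE; under eq_bigr => j _ do rewrite !mxE mulrBl.
rewrite sumrB (bigD1 i) //= eqxx mulr1n big1 ?addr0 => [|j]; last first.
  by rewrite eq_sym => /negbTE ->; rewrite mulr0n mul0r.
under [RHS]eq_bigr => v _ do rewrite mulrBr.
rewrite sumrB -mulr_suml; congr (_ * _ - _).
  by rewrite -natr_sum /degree -sum1_card big_mkcond.
by rewrite (sum_enum_val (fun v => (adj (enum_val i) v)%:R * x v)).
Qed.

Lemma laplacian_form {R : realType} {G : sgraph} (x : G -> R) :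
  let v : 'rV[R]_#|G| := \row_i x (enum_val i) in
  (v *m laplacian R G *m v^T) 0 0 = dirichlet x.
Proof.
rewrite /= -mulmxA mxE /dirichlet -sum_enum_val; apply: eq_bigr => i _.
rewrite laplacian_mulE mxE mulr_sumr; apply: eq_bigr => v _.
by rewrite mulrCA.
Qed.

Lemma dirichlet_sub {R : realType} {G : sgraph} (x : G -> R) (m : R) :
  dirichlet (fun u => x u - m) = dirichlet x.
Proof.
apply/eqP; rewrite -subr_eq0 /dirichlet -sumrB; apply/eqP.
under eq_bigr => u _ do rewrite -sumrB.
(* Only a linear term is left, and reversing all arcs shows that it vanishes. *)
transitivity (- m * (\sum_u \sum_(v : G) (adj u v)%:R * x u -
                     \sum_u \sum_(v : G) (adj u v)%:R * x v)).
  rewrite -sumrB mulr_sumr; apply: eq_bigr => u _.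
  rewrite -sumrB mulr_sumr; apply: eq_bigr => v _; ring.
rewrite [X in _ - X]exchange_big /=; apply/eqP; rewrite mulf_eq0 subr_eq0.
apply/orP; right; apply/eqP/eq_bigr => u _; apply: eq_bigr => v _.
by rewrite adj_sym.
Qed.

Lemma sum_sqr_sub_mean {R : realType} {G : sgraph} (x : G -> R) :
  (0 < #|G|)%N ->
  \sum_u (x u - (\sum_v x v) / #|G|%:R) ^+ 2 =
  \sum_u x u ^+ 2 - (\sum_u x u) ^+ 2 / #|G|%:R.
Proof.
move=> Gpos; under eq_bigr => u _ do rewrite sqrrB.
rewrite big_split sumrB /= sumr_const -mulr_natl sumrMnl -mulr_suml.
by rewrite -mulr_natl; field; rewrite pnatr_eq0 -lt0n.
Qed.

Lemma card_gt0_eigenvalue2 {R : realType} {G : sgraph} :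
  0 < laplacian_eigenvalue R G 2 -> (0 < #|G|)%N.
Proof.
case: posnP => // G0; rewrite /laplacian_eigenvalue nth_default ?ltxx //.
by rewrite size_laplacian_eigenvalues G0.
Qed.

(** The kernel vector for [rayleigh_ge] is the all-ones vector, to which [x] is orthogonal. *)
Lemma dirichlet_ge_sum0 {R : realType} {G : sgraph} (x : G -> R) :
  0 < laplacian_eigenvalue R G 2 -> \sum_u x u = 0 ->
  laplacian_eigenvalue R G 2 * \sum_u x u ^+ 2 <= dirichlet x.
Proof.
move=> mu0 x0; have /card_gt0P[w _] := card_gt0_eigenvalue2 mu0.
rewrite -laplacian_form.
have := @rayleigh_ge R _ (laplacian R G) (const_mx 1) (\row_i x (enum_val i))
  (laplacian_sym R G).
rewrite !mxE; under [X in _ * X <= _]eq_bigr => i _ do rewrite !mxE -expr2.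
rewrite (sum_enum_val (fun u => x u ^+ 2)); apply => //.
- rewrite -[LHS]trmxK trmx_mul laplacian_sym; apply/rowP => i.
  have := laplacian_mulE (fun=> 1 : R) i.
  rewrite (_ : \row_j 1 = const_mx 1); last by apply/rowP => j; rewrite !mxE.
  move=> L1; rewrite [LHS]mxE [RHS]mxE L1.
  by rewrite big1 // => v _; rewrite subrr mulr0.
- by apply/eqP => /rowP/(_ (enum_rank w)); rewrite !mxE => /eqP; rewrite oner_eq0.
- apply/matrixP => i j; rewrite !mxE -[RHS]x0 -sum_enum_val.
  by apply: eq_bigr => k _; rewrite !mxE mulr1.
Qed.

Lemma dirichlet_ge {R : realType} {G : sgraph} (x : G -> R) :
  0 < laplacian_eigenvalue R G 2 ->
  laplacian_eigenvalue R G 2 *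
    (\sum_u x u ^+ 2 - (\sum_u x u) ^+ 2 / #|G|%:R) <= dirichlet x.
Proof.
move=> mu0; have Gpos := card_gt0_eigenvalue2 mu0.
rewrite -sum_sqr_sub_mean // -(dirichlet_sub x ((\sum_v x v) / #|G|%:R)).
apply: dirichlet_ge_sum0 => //; rewrite sumrB sumr_const -[_ *+ _]mulr_natr.
by rewrite mulfVK ?subrr // pnatr_eq0 -lt0n.
Qed.

(** Centring [x] at its mean keeps the form and shrinks the norm; this yields the factor
    [#|G| - #|S|] in [edge_cut_le]. *)
Lemma dirichlet_le {R : realType} {G : sgraph} (x : G -> R) :
  dirichlet x <= laplacian_eigenvalue R G #|G| *
    (\sum_u x u ^+ 2 - (\sum_u x u) ^+ 2 / #|G|%:R).
Proof.
have [/card0_eq G0|Gpos] := posnP #|G|.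
  by rewrite /dirichlet !big_pred0 ?expr0n /= ?mul0r ?subrr ?mulr0.
set m := (\sum_u x u) / #|G|%:R; rewrite -(dirichlet_sub x m) -laplacian_form.
apply: le_trans (rayleigh_le _ _ (laplacian_sym R G)) _.
rewrite le_eqVlt; apply/orP; left; apply/eqP; congr (_ * _).
rewrite mxE; under eq_bigr => i _ do rewrite !mxE -expr2.
by rewrite (sum_enum_val (fun u => (x u - m) ^+ 2)) sum_sqr_sub_mean.
Qed.

(** The identity holds arc by arc: as [B] and [C] are not joined, an arc leaving one of them ends
    where the vector is 0. *)
Lemma dirichlet_indicators {R : realType} {G : sgraph} (B C : {set G}) (a b : R) :
  [disjoint B & C] -> {in B & C, forall u v, ~~ adj u v} ->
  dirichlet (fun u => a * (u \in B)%:R - b * (u \in C)%:R) =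
  a ^+ 2 * edge_cut R B + b ^+ 2 * edge_cut R C.
Proof.
move=> BC nadj; rewrite /dirichlet /edge_cut !mulr_sumr -big_split /=.
apply: eq_bigr => u _; rewrite !mulr_sumr -big_split /=; apply: eq_bigr => v _.
have dis w : w \in B -> (w \in C) = false by move=> ?; rewrite (disjointFr BC).
have [auv|] := boolP (adj u v); last by rewrite !mul0r !mulr0 addr0.
have [uB|uB] := boolP (u \in B).
  rewrite dis //; have [vB|vB] := boolP (v \in B); first by rewrite dis //=; ring.
  have [vC|vC] := boolP (v \in C); last by rewrite /=; ring.
  by have := nadj _ _ uB vC; rewrite auv.
have [uC|uC] := boolP (u \in C); last by rewrite /=; ring.
have [vC|vC] := boolP (v \in C).
  by rewrite (disjointFl BC) //=; ring.
have [vB|vB] := boolP (v \in B); last by rewrite /=; ring.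
by have := nadj _ _ vB uC; rewrite adj_sym auv.
Qed.

Lemma sum_indicators {R : realType} {G : sgraph} (B C : {set G}) (a b : R) :
  \sum_u (a * (u \in B)%:R - b * (u \in C)%:R) = a * #|B|%:R - b * #|C|%:R.
Proof. by rewrite sumrB -!mulr_sumr -!natr_sum -!sum1_card -!big_mkcond. Qed.

Lemma sum_sqr_indicators {R : realType} {G : sgraph} (B C : {set G}) (a b : R) :
  [disjoint B & C] ->
  \sum_u (a * (u \in B)%:R - b * (u \in C)%:R) ^+ 2 =
  a ^+ 2 * #|B|%:R + b ^+ 2 * #|C|%:R.
Proof.
move=> BC; rewrite -!sum1_card !natr_sum !mulr_sumr.
rewrite [X in _ = X + _]big_mkcond [X in _ = _ + X]big_mkcond -big_split /=.
apply: eq_bigr => u _; have [uB|uB] := boolP (u \in B).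
  by rewrite (disjointFr BC) //=; ring.
by case: (u \in C) => /=; ring.
Qed.

Lemma dirichlet_indicator {R : realType} {G : sgraph} (B : {set G}) :
  let x := fun u : G => (u \in B)%:R : R in
  [/\ dirichlet x = edge_cut R B, \sum_u x u = #|B|%:R & \sum_u x u ^+ 2 = #|B|%:R].
Proof.
move=> x; have dis : [disjoint B & @set0 G].
  by rewrite disjoint_sym disjoints_subset sub0set.
have xE : x = (fun u => 1 * (u \in B)%:R - 0 * (u \in set0)%:R).
  by apply/funext => u; rewrite mul1r mul0r subr0.
rewrite xE dirichlet_indicators // => [|u v _]; last by rewrite inE.
rewrite sum_indicators sum_sqr_indicators //.
by rewrite expr1n expr0n !mul1r !mul0r subr0 !addr0.
Qed.

Lemma edge_cut_le {R : realType} {G : sgraph} (S : {set G}) :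
  #|G|%:R * edge_cut R S <=
  laplacian_eigenvalue R G #|G| * (#|S|%:R * (#|G|%:R - #|S|%:R)).
Proof.
have [G0|Gpos] := posnP #|G|.
  have := max_card (mem S); rewrite G0 leqn0 => /eqP->.
  by rewrite !mul0r mulr0.
have n0 : (0 : R) < #|G|%:R by rewrite ltr0n.
have [dE sE qE] := @dirichlet_indicator R G S.
have := dirichlet_le (fun u => (u \in S)%:R : R); rewrite dE sE qE.
rewrite -(ler_pM2l n0) => le; apply: le_trans le _.
rewrite le_eqVlt; apply/orP; left; apply/eqP; field.
by rewrite gt_eqF.
Qed.

Lemma edge_cut_ge {R : realType} {G : sgraph} (B : {set G}) :
  0 < laplacian_eigenvalue R G 2 ->
  laplacian_eigenvalue R G 2 * (#|B|%:R * (#|G|%:R - #|B|%:R)) <= #|G|%:R * edge_cut R B.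
Proof.
move=> mu0; have n0 : (0 : R) < #|G|%:R by rewrite ltr0n (@card_gt0_eigenvalue2 R).
have [dE sE qE] := @dirichlet_indicator R G B.
have := dirichlet_ge (fun u => (u \in B)%:R : R) mu0; rewrite dE sE qE.
rewrite -(ler_pM2l n0) => le; apply: le_trans _ le.
rewrite le_eqVlt; apply/orP; left; apply/eqP; field.
by rewrite gt_eqF.
Qed.

(** The test vector is [#|C|] on [B] and [- #|B|] on [C], weights for which the entries sum to 0. *)
Lemma edge_cut_pair_ge {R : realType} {G : sgraph} (B C : {set G}) :
  0 < laplacian_eigenvalue R G 2 ->
  [disjoint B & C] -> {in B & C, forall u v, ~~ adj u v} ->
  laplacian_eigenvalue R G 2 * (#|B|%:R * #|C|%:R * (#|B|%:R + #|C|%:R)) <=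
  #|C|%:R ^+ 2 * edge_cut R B + #|B|%:R ^+ 2 * edge_cut R C.
Proof.
move=> mu0 BC nadj; rewrite -dirichlet_indicators //.
apply: le_trans (dirichlet_ge _ mu0).
rewrite sum_indicators [#|B|%:R * #|C|%:R]mulrC subrr expr0n mul0r subr0.
by rewrite sum_sqr_indicators // le_eqVlt; apply/orP; left; apply/eqP; ring.
Qed.

(** * Spectral bound from a separating set *)

Definition nonadjacent_parts {G : sgraph} (P : {set {set G}}) : Prop :=
  forall B C u v, B \in P -> C \in P -> B != C -> u \in B -> v \in C -> ~~ adj u v.

(** An edge leaving a part can only end in [S], and its end outside [S] lies in exactly one part. *)
Lemma sum_edge_cut {R : realType} {G : sgraph} (S : {set G}) (P : {set {set G}}) :
  partition P (setC S) -> nonadjacent_parts P ->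
  \sum_(B in P) edge_cut R B = edge_cut R S.
Proof.
move=> /and3P[/eqP covP trivP _] sepP; rewrite /edge_cut.
rewrite exchange_big [RHS]exchange_big /=.
apply: eq_bigr => u _; rewrite exchange_big /=; apply: eq_bigr => v _.
rewrite [in RHS]adj_sym; have [uS|uS] := boolP (u \in S).
  rewrite /= !andbF big1 // => B BP.
  suff -> : (u \in B) = false by rewrite andbF.
  apply: contraTF uS => uB; rewrite -in_setC -covP.
  by apply/bigcupP; exists B.
have ucov : u \in cover P by rewrite covP in_setC.
rewrite (bigD1 (pblock P u)) ?pblock_mem //= big1 => [|B /andP[BP Bu]].
  rewrite addr0 mem_pblock ucov /=; case auv: (adj u v) => //=.
  rewrite andbT; congr (_%:R); congr nat_of_bool.
  have [vS|vS] := boolP (v \in S).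
    apply/negP => vu; move: vS; apply/negP; rewrite -in_setC -covP.
    by apply/bigcupP; exists (pblock P u) => //; exact: pblock_mem.
  have vcov : v \in cover P by rewrite covP in_setC.
  apply/negbTE; rewrite negbK -eq_pblock // eq_sym.
  apply: contraTT auv => uv; apply: (sepP (pblock P u) (pblock P v)) => //.
  - exact: pblock_mem.
  - exact: pblock_mem.
  - by rewrite eq_sym.
  - by rewrite mem_pblock.
  - by rewrite mem_pblock.
suff -> : (u \in B) = false by rewrite andbF.
by apply: contraNF Bu => uB; rewrite (def_pblock trivP BP uB).
Qed.

(* At most one part [k] can have [e k < mu * c k], and then every other part
   compensates for it through the pair inequality. *)
Lemma sum_cut_parts_ge {R : realFieldType} {I : finType} (P : {set I})
    (c e : I -> R) (mu n : R) :
  (1 < #|P|)%N -> 0 < mu -> 0 < n -> {in P, forall i, 1 <= c i} ->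
  {in P, forall i, mu * (c i * (n - c i)) <= n * e i} ->
  {in P &, forall i j, i != j ->
    mu * (c i * c j * (c i + c j)) <= c j ^+ 2 * e i + c i ^+ 2 * e j} ->
  exists2 k, k \in P &
    mu * (n * (\sum_(i in P) c i) - c k ^+ 2 + 1) <= n * \sum_(i in P) e i.
Proof.
move=> P1 mu0 n0 c1 eone epair; have [k0 k0P] : exists k, k \in P.
  by apply/card_gt0P/ltnW.
have [/forall_inP allge|] := boolP [forall i in P, mu * c i <= e i].
  exists k0 => //; have := c1 k0 k0P => ck.
  have : mu * (\sum_(i in P) c i) <= \sum_(i in P) e i.
    by rewrite mulr_sumr; exact: ler_sum.
  rewrite -(ler_pM2l n0).
  have : 0 <= mu * (c k0 ^+ 2 - 1) by apply: mulr_ge0; [exact: ltW|nra].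
  set sc := \sum_(i in P) c i; set se := \sum_(i in P) e i; lra.
rewrite negb_forall_in => /exists_inP[k kP]; rewrite -ltNge => ek.
exists k => //.
have ck := c1 k kP.
(* The pair inequality rearranged: the surplus [e i - mu * c i] is at least [(c i / c k) ^+ 2] times
   the deficit of [k]. *)
have other i : i \in P -> i != k ->
    mu * c i * c k ^+ 2 + c i ^+ 2 * (mu * c k - e k) <= c k ^+ 2 * e i.
  move=> iP ik; have := epair i k iP kP ik; nra.
have otherge i : i \in P -> i != k -> mu * c i <= e i.
  move=> iP ik; have := other i iP ik; have := c1 i iP => ci le.
  rewrite -(@ler_pM2l _ (c k ^+ 2)); last by nra.
  nra.
have /card_gt0P[j] : (0 < #|P :\ k|)%N.
  by move: P1; rewrite (cardsD1 k) kP.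
rewrite !inE => /andP[jk jP].
rewrite (bigD1 k) //= [X in _ <= n * X](bigD1 k) //=.
rewrite (bigD1 j) ?jP //= [X in _ <= n * (_ + X)](bigD1 j) ?jP //=.
set sc := \sum_(l | _) c l; set se := \sum_(l | _) e l.
have le_s : mu * sc <= se.
  rewrite /sc mulr_sumr; apply: ler_sum => l /andP[/andP[lP lk] _].
  exact: otherge.
have ej := other j jP jk; have cj := c1 j jP; have ekge := eone k kP.
set del := mu * c k - e k in ej.
have del0 : 0 < del by rewrite /del subr_gt0.
have cj2 : 1 <= c j ^+ 2 by nra.
have ck2 : 1 <= c k ^+ 2 by nra.
have ndel : n * del <= mu * c k ^+ 2 by rewrite /del; lra.
have dele : del <= c k ^+ 2 * (e j - mu * c j) by nra.
have ndele : n * del <= c k ^+ 2 * (n * (e j - mu * c j)).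
  by rewrite mulrCA ler_pM2l.
have ndelk : n * del * (c k ^+ 2 - 1) <= mu * c k ^+ 2 * (c k ^+ 2 - 1).
  by apply: ler_wpM2r => //; rewrite subr_ge0.
have nle_s : n * (mu * sc) <= n * se by rewrite ler_pM2l.
(* After scaling by [c k ^+ 2], [ndele] reduces the claim to [0 <= (c k ^+ 2 - 1) * (mu * c k ^+ 2 -
   n * del)], which is [ndelk]. *)
suff : 0 <= c k ^+ 2 * (n * (e j - mu * c j) - n * del + mu * (c k ^+ 2 - 1)).
  rewrite pmulr_rge0 ?(lt_le_trans ltr01) // /del; lra.
lra.
Qed.

(* [s] is the size of the separating set, [c] that of the part singled out by
   [sum_cut_parts_ge], [p] that of the other parts, [E] the size of the cut. *)
Lemma barrier_arith {R : realFieldType} (r mu2 mun n s p c d E : R) :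
  0 < r -> 0 < mun -> r * mun <= mu2 -> n = s + p + c -> 0 <= s -> s <= p ->
  1 <= c -> s + d <= p + 1 ->
  mu2 * (n * (p + c) - c ^+ 2 + 1) <= n * E ->
  n * E <= mun * (s * (p + c)) ->
  2 * (r * n) <= n - d.
Proof.
move=> r0 mun0 rmu nE s0 sp c1 sd lo up.
pose X := n * (p + c) - c ^+ 2 + 1.
have X0 : 0 < X by rewrite /X; nra.
have rX : r * X <= s * (p + c).
  rewrite -(ler_pM2l mun0); apply: le_trans up; apply: le_trans lo.
  by rewrite -/X mulrA [mun * r]mulrC ler_wpM2r // ltW.
(* From [s + d <= p + 1] one gets [2 * s + c - 1 <= n - d], so it suffices to prove the bound with
   this smaller factor, free of [d]. *)
have key : 2 * n * (s * (p + c)) <= (n - d) * X.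
  have : 2 * n * (s * (p + c)) <= (2 * s + c - 1) * X.
    (* This product is exactly the difference of the two sides. *)
    have : 0 <= (c - 1) * (s * p + p ^+ 2 + 2 * p * c - s * c - 2 * s + 1).
      apply: mulr_ge0; first lra.
      have : 0 <= c * (p - s) by apply: mulr_ge0; lra.
      have : 0 <= s * (p - s) by apply: mulr_ge0; lra.
      have : 0 <= s * (c - 1) by apply: mulr_ge0; lra.
      have := sqr_ge0 (p - s); have := sqr_ge0 (s - 1); have := sqr_ge0 s; lra.
    rewrite /X nE; lra.
  have : (2 * s + c - 1) <= n - d by lra.
  nra.
rewrite -(ler_pM2r X0); apply: le_trans key; nra.
Qed.

Lemma barrier_spectral_bound {R : realType} {G : sgraph} (S : {set G})
    (P : {set {set G}}) (d : nat) (r : R) :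
  partition P (~: S) -> nonadjacent_parts P ->
  (1 < #|P|)%N -> (0 < d)%N -> (#|S| + d <= #|P|)%N ->
  0 < r -> 0 < laplacian_eigenvalue R G #|G| ->
  r * laplacian_eigenvalue R G #|G| <= laplacian_eigenvalue R G 2 ->
  2 * (r * #|G|%:R) <= #|G|%:R - d%:R.
Proof.
move=> partP sepP P1 d0 Sd r0 mun0 rmu; have /and3P[_ trivP P0] := partP.
have mu0 : 0 < laplacian_eigenvalue R G 2 by apply: lt_le_trans rmu; exact: mulr_gt0.
have cardP := card_partition partP.
have cB B : B \in P -> (0 < #|B|)%N.
  by move=> BP; rewrite card_gt0; apply: contraNneq P0 => <-.
have nS := cardsC S.
have n0 : (0 : R) < #|G|%:R.
  have /card_gt0P[B BP] : (0 < #|P|)%N by exact: ltnW.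
  by rewrite ltr0n (leq_trans (cB B BP)) // max_card.
have [|B BP|B C BP CP BC|k kP] := @sum_cut_parts_ge R _ P (fun B => #|B|%:R)
    (edge_cut R) (laplacian_eigenvalue R G 2) #|G|%:R P1 mu0 n0.
- by move=> B BP; rewrite ler1n cB.
- exact: edge_cut_ge.
- apply: edge_cut_pair_ge => //; first exact: (trivIsetP trivP).
  by move=> u v uB vC; exact: (sepP B C).
rewrite -natr_sum -cardP (sum_edge_cut _ _ partP sepP) => lo.
have up := @edge_cut_le R G S.
(* The parts other than [k] are nonempty, so they number at most [p], the count of their vertices.
   With [#|S| + d <= #|P|] and [0 < d] this gives both [s <= p] and [s + d <= p + 1]. *)
have pk : (#|P| <= (#|G| - #|S| - #|k|).+1)%N.
  rewrite -nS addKn cardP (bigD1 k) //= addKn (cardsD1 k) kP ltnS.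
  rewrite -sum1_card (eq_bigl (fun B => (B \in P) && (B != k))); last first.
    by move=> B; rewrite !inE andbC.
  by apply: leq_sum => B /andP[BP _]; exact: cB.
have kS : (#|k| + #|S| <= #|G|)%N.
  by rewrite -nS addnC leq_add2l cardP (bigD1 k) //= leq_addr.
have nE : #|G| = (#|S| + (#|G| - #|S| - #|k|) + #|k|)%N by clear - kS; lia.
set p := (_ - _)%N in pk nE.
have rnE : #|G|%:R = #|S|%:R + p%:R + #|k|%:R :> R by rewrite -!natrD -nE.
have SCE : #|~: S|%:R = p%:R + #|k|%:R :> R.
  by rewrite -natrD; congr _%:R; clear - nS nE; lia.
rewrite SCE in lo.
apply: (barrier_arith r _ _ _ _ _ _ _ _ r0 mun0 rmu rnE _ _ _ _ lo) => //.
- by rewrite ler_nat; clear - Sd pk d0; lia.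
- by rewrite ler1n cB.
- by rewrite -natrD natr1 ler_nat; clear - Sd pk; lia.
- have nsE : #|G|%:R - #|S|%:R = p%:R + #|k|%:R :> R by rewrite rnE; ring.
  by rewrite -nsE.
Qed.

(** * Maximum matchings and Gallai's exchange *)

Lemma edgesP {G : sgraph} (e : {set G}) :
  reflect (exists x y, adj x y /\ e = [set x; y]) (e \in edges G).
Proof.
apply: (iffP imsetP) => [[[x y] /= xy ->]|[x [y [xy ->]]]].
  by exists x, y; split=> //; rewrite inE in xy.
by exists (x, y).
Qed.

Lemma card_edge {G : sgraph} (e : {set G}) : e \in edges G -> #|e| = 2%N.
Proof.
move=> /edgesP[x [y [xy ->]]]; rewrite cards2; case: eqVneq xy => // ->.
by rewrite adj_irr.
Qed.

Lemma card_cover_matching {G : sgraph} (M : {set {set G}}) :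
  is_matching M -> #|cover M| = (#|M| * 2)%N.
Proof.
move=> /andP[/subsetP ME /eqP <-].
by rewrite -sum_nat_const; apply: eq_bigr => e /ME/card_edge.
Qed.

Lemma matching_same {G : sgraph} (M : {set {set G}}) (e f : {set G}) (x : G) :
  is_matching M -> e \in M -> f \in M -> x \in e -> x \in f -> e = f.
Proof.
move=> /andP[_ trivM] eM fM xe xf.
by rewrite -(def_pblock trivM eM xe) (def_pblock trivM fM xf).
Qed.

Lemma matching_sub {G : sgraph} (M N : {set {set G}}) :
  is_matching M -> N \subset M -> is_matching N.
Proof.
move=> /andP[ME trivM] NM; rewrite /is_matching (subset_trans NM ME).
exact: trivIsetS trivM.
Qed.

Lemma matching_add {G : sgraph} (M : {set {set G}}) (e : {set G}) :
  is_matching M -> e \in edges G -> [disjoint e & cover M] ->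
  is_matching (e |: M) /\ #|e |: M| = #|M|.+1.
Proof.
move=> mM eE dis; have /andP[/subsetP ME trivM] := mM.
have eM : e \notin M.
  apply/negP => eM; have := card_edge _ eE.
  have [x xe|e0] := pickP (mem e); last by rewrite (eq_card0 e0).
  have : x \in cover M by apply/bigcupP; exists e.
  by rewrite (disjointFr dis).
split; last by rewrite cardsU1 eM.
apply/andP; split; first by rewrite subUset sub1set eE; apply/subsetP.
have [] // := @trivIsetU1 _ e M.
- move=> f fM; rewrite disjoint_sym disjoints_subset; apply/subsetP => x xf.
  rewrite inE; apply/negP => xe; have : x \in cover M by apply/bigcupP; exists f.
  by rewrite (disjointFr dis).
- by apply/negP => /ME/card_edge; rewrite cards0.
Qed.

(** These are the matchings of the subgraph induced on [X]; with [X] a set, vertices can be deleted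
    without changing the graph type. *)
Definition matching_in {G : sgraph} (X : {set G}) (M : {set {set G}}) : bool :=
  is_matching M && (cover M \subset X).

Definition matching_number_in {G : sgraph} (X : {set G}) : nat :=
  (\max_(M : {set {set G}} | matching_in X M) #|M|)%N.

Definition max_matching {G : sgraph} (X : {set G}) (M : {set {set G}}) : bool :=
  matching_in X M && (#|M| == matching_number_in X).

Lemma matching_in0 {G : sgraph} (X : {set G}) : matching_in X set0.
Proof.
rewrite /matching_in /is_matching sub0set /cover big_set0 sub0set /=.
by rewrite /trivIset /cover !big_set0 cards0.
Qed.

Lemma leq_matching_number_in {G : sgraph} (X : {set G}) (M : {set {set G}}) :
  matching_in X M -> (#|M| <= matching_number_in X)%N.
Proof. by move=> MX; rewrite /matching_number_in (bigD1 M) //= leq_maxl. Qed.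

Lemma max_matching_exists {G : sgraph} (X : {set G}) : exists M, max_matching X M.
Proof.
have [M MX MnX] := eq_bigmax_cond (fun M : {set {set G}} => #|M|)
  (introT card_gt0P (ex_intro (fun M => M \in matching_in X) _ (matching_in0 X))).
by exists M; apply/andP; split; [exact: MX|apply/eqP; rewrite -MnX].
Qed.

Lemma max_matching_missed {G : sgraph} (X : {set G}) (M : {set {set G}}) (e : {set G}) :
  max_matching X M -> e \in edges G -> e \subset X -> ~~ [disjoint e & cover M].
Proof.
move=> /andP[/andP[mM MX] /eqP cM] eE eX; apply/negP => dis.
have [meM ceM] := matching_add _ _ mM eE dis.
have : matching_in X (e |: M).
  by rewrite /matching_in meM /cover bigcup_setU big_set1 subUset eX.
by move=> /leq_matching_number_in; rewrite ceM cM ltnn.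
Qed.

(* Gallai's exchange: [N] is chosen to share as many edges as possible with [M]. *)
Lemma gallai_exchange {G : sgraph} (X : {set G}) (M : {set {set G}}) (u v t : G) :
  max_matching X M -> u != v -> u \in X :\: cover M -> v \in X :\: cover M ->
  (exists N, max_matching X N && (t \notin cover N)) ->
  exists2 N, max_matching X N &
    (t \notin cover N) && ((u \notin cover N) || (v \notin cover N)).
Proof.
move=> maxM uv uM vM [N0 N0P].
case: (@arg_maxnP _ N0 (fun N => max_matching X N && (t \notin cover N))
  (fun N => #|M :&: N|) N0P) => N /andP[maxN tN] Nopt.
exists N => //; rewrite tN /= -negb_and; apply/negP => /andP[uN vN].
have /andP[/andP[mM MX] /eqP cM] := maxM; have /andP[/andP[mN NX] /eqP cN] := maxN.
have ccov : #|cover M| = #|cover N| by rewrite !card_cover_matching // cM cN.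
(* Both covers have the same size, and [u], [v] are covered by [N] only; so at least two vertices
   are covered by [M] only, one of them not [t]. *)
have [x xM xt] : exists2 x, x \in cover M :\: cover N & x != t.
  have c2 : (1 < #|cover M :\: cover N|)%N.
    have : (1 < #|cover N :\: cover M|)%N.
      move: uM vM; rewrite !inE => /andP[uM _] /andP[vM _].
      by rewrite (cardsD1 u) (cardsD1 v) !inE uN vN uM vM eq_sym uv.
    by rewrite !cardsD finset.setIC ccov.
  have /card_gt0P[x] : (0 < #|(cover M :\: cover N) :\ t|)%N.
    by move: c2; rewrite (cardsD1 t); case: (_ \in _) => [|/ltnW].
  by rewrite in_setD1 => /andP[xt xM]; exists x.
move: xM; rewrite inE => /andP[xN /bigcupP[e eM xe]].
have eE : e \in edges G by case/andP: mM => /subsetP/(_ e eM).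
have eX : e \subset X by apply: subset_trans MX; apply: (bigcup_max e).
have /pred0Pn[y /andP[/= ye yN]] := max_matching_missed _ _ _ maxN eE eX.
have /bigcupP[f fN yf] := yN.
have fM : f \notin M.
  apply/negP => fM; move: xN; rewrite (matching_same _ _ _ _ mM eM fM ye yf) in xe.
  by move=> /negP[]; apply/bigcupP; exists f.
(* Replacing [f] by [e] in [N] keeps the size, still misses [t] and gains an edge of [M], against
   the choice of [N]. *)
have mN' : is_matching (N :\ f) by apply: matching_sub mN _; exact: subD1set.
have covN' : cover (N :\ f) = cover N :\: f by apply: coverD1 => //; case/andP: mN.
have exy : e = [set x; y].
  apply/esym/eqP; rewrite eqEcard subUset !sub1set xe ye (card_edge _ eE) cards2.
  by case: eqVneq xN => // ->; rewrite yN.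
have dis : [disjoint e & cover (N :\ f)].
  rewrite covN'; apply/pred0Pn => -[z /andP[/= ze]]; rewrite inE => /andP[zf zN].
  move: ze zf zN; rewrite exy !inE => /orP[]/eqP->; first by rewrite (negbTE xN).
  by rewrite yf.
have [mN2 cN2] := matching_add _ _ mN' eE dis.
have covN2 : cover (e |: N :\ f) = e :|: (cover N :\: f).
  by rewrite /cover bigcup_setU big_set1 -covN'.
have te : t \notin e.
  rewrite exy !inE negb_or eq_sym xt /=.
  by apply: contraNneq tN => ->.
have := Nopt (e |: N :\ f).
have -> /= : max_matching X (e |: N :\ f) && (t \notin cover (e |: N :\ f)).
  rewrite /max_matching /matching_in mN2 cN2 covN2 subUset eX /=.
  rewrite (subset_trans (subsetDl _ _) NX) /= -cN (cardsD1 f N) fN eqxx /=.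
  by rewrite !inE (negbTE te) (negbTE tN) andbF.
move=> /(_ isT); rewrite leqNgt => /negP[]; apply: proper_card.
apply/properP; split.
  apply/subsetP => g; rewrite !inE => /andP[gM gN]; rewrite gM gN andbT /=.
  by apply/orP; right; apply: contraNneq fM => <-.
exists e; rewrite !inE ?eM ?eqxx //=.
by apply/negP => eN; move/negP: xN; apply; apply/bigcupP; exists e.
Qed.

(** * The Tutte-Berge barrier *)

Definition missable {G : sgraph} (X : {set G}) (v : G) : bool :=
  [exists M, max_matching X M && (v \notin cover M)].

Definition jointly_missable {G : sgraph} (X : {set G}) (u v : G) : bool :=
  [exists M, [&& max_matching X M, u \notin cover M & v \notin cover M]].

(** The last clause says that [#|P| - #|S|] is at least the deficiency
    [#|X| - 2 * matching_number_in X], written without truncated subtraction. *)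
Definition has_barrier {G : sgraph} (X S : {set G}) (P : {set {set G}}) : Prop :=
  [/\ S \subset X, partition P (X :\: S), nonadjacent_parts P &
      (#|S| + #|X| <= #|P| + 2 * matching_number_in X)%N].

(** Deleting [a] lowers the matching number, since otherwise a maximum matching of [X :\ a] would be
    one of [X] missing [a]. This drop pays for the extra element of [S] and of [X]. *)
Lemma has_barrier_setD1 {G : sgraph} (X S : {set G}) (P : {set {set G}}) (a : G) :
  a \in X -> ~~ missable X a -> has_barrier (X :\ a) S P ->
  has_barrier X (a |: S) P.
Proof.
move=> aX naX [SX partP sepP le]; split=> //.
- by rewrite subUset sub1set aX (subset_trans SX) // subD1set.
- by rewrite -finset.setDDl.
have aS : a \notin S by apply/negP => /(subsetP SX); rewrite !inE eqxx.
have [M /andP[/andP[mM MX] /eqP cM]] := max_matching_exists (X :\ a).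
have MX' : matching_in X M.
  by rewrite /matching_in mM (subset_trans MX) // subD1set.
have lt : (#|M| < matching_number_in X)%N.
  rewrite ltn_neqAle leq_matching_number_in // andbT; apply: contra naX => cMX.
  apply/existsP; exists M; rewrite /max_matching MX' cMX /=.
  by apply/negP => /(subsetP MX); rewrite !inE eqxx.
rewrite cardsU1 aS (cardsD1 a X) aX; rewrite -cM in le.
by move: le lt; lia.
Qed.

(** Transitivity is the exchange: a maximum matching missing [u] and [v], and one missing [t], yield
    one missing [t] together with [u] or [v]. The equality disjunct gives reflexivity, as a missable
    vertex is jointly missable with itself. *)
Lemma gallai_equivalence {G : sgraph} (X : {set G}) :
  {in X, forall v, missable X v} ->
  {in X & &, equivalence_rel (fun u v => (u == v) || ~~ jointly_missable X u v)}.
Proof.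
move=> missX.
have sym u v : jointly_missable X u v = jointly_missable X v u.
  by apply: eq_existsb => M; rewrite [X in _ && X]andbC.
have trans u t v : u \in X -> t \in X -> v \in X ->
    ~~ jointly_missable X u t -> ~~ jointly_missable X t v -> u != v ->
    ~~ jointly_missable X u v.
  move=> uX tX vX ut tv uv; apply/negP => /existsP[M /and3P[maxM uM vM]].
  have uXM : u \in X :\: cover M by rewrite inE uM uX.
  have vXM : v \in X :\: cover M by rewrite inE vM vX.
  have [N maxN /andP[tN /orP[uN|vN]]] :=
    gallai_exchange _ _ _ _ _ maxM uv uXM vXM (existsP (missX t tX)).
  - by move/negP: ut; apply; apply/existsP; exists N; rewrite maxN uN.
  - by move/negP: tv; apply; apply/existsP; exists N; rewrite maxN tN.
pose R u v := (u == v) || ~~ jointly_missable X u v.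
have symR u v : R u v = R v u by rewrite /R eq_sym sym.
have transR u t v : u \in X -> t \in X -> v \in X -> R u t -> R t v -> R u v.
  move=> uX tX vX; rewrite /R; case: (eqVneq u t) => [-> _ //|_ /= ut].
  case: (eqVneq t v) => [<- _|_ /= tv]; first by rewrite ut orbT.
  by case: (eqVneq u v) => //= uv; exact: (trans u t v).
apply/equivalence_relP_in; split=> [u uX|u v uX vX Ruv w wX]; first by rewrite eqxx.
by apply/idP/idP; apply: transR => //; rewrite -/(R _ _) symR.
Qed.

Lemma barrier_exists {G : sgraph} (X : {set G}) :
  exists S P, has_barrier X S P.
Proof.
have [n] := ubnP #|X|; elim: n X => // n IHn X ltXn.
have [/forall_inP missX|] := boolP [forall v in X, missable X v]; last first.
  rewrite negb_forall_in => /exists_inP[a aX naX].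
  have [|S [P SP]] := IHn (X :\ a); first by move: ltXn; rewrite (cardsD1 a) aX.
  by exists (a |: S), P; exact: has_barrier_setD1.
pose R u v := (u == v) || ~~ jointly_missable X u v.
have eqR : {in X & &, equivalence_rel R} := gallai_equivalence X missX.
exists finset.set0, (equivalence_partition R X); set P := equivalence_partition R X.
have partP : partition P X := equivalence_partitionP eqR.
have /and3P[/eqP covP trivP _] := partP.
have inP B u : B \in P -> u \in B -> u \in X.
  by move=> BP uB; rewrite -covP; apply/bigcupP; exists B.
have sameR B u v : B \in P -> u \in B -> v \in X -> R u v -> v \in B.
  move=> BP uB vX Ruv; rewrite -(def_pblock trivP BP uB).
  by rewrite pblock_equivalence_partition // (inP B).
split.
- by rewrite sub0set.
- by rewrite finset.setD0.
- move=> B C u v BP CP BC uB vC; apply: contra BC => auv; apply/eqP.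
  have uX := inP _ _ BP uB; have vX := inP _ _ CP vC.
  suff vB : v \in B by rewrite -(def_pblock trivP BP vB) (def_pblock trivP CP vC).
  (* Adjacent vertices are never both missed by a maximum matching, so they are equivalent. *)
  apply: (sameR B u) => //; apply/orP; right; apply/negP.
  move=> /existsP[M /and3P[maxM uM vM]].
  apply: (negP (max_matching_missed X M [set u; v] maxM _ _)).
  + by apply/edgesP; exists u, v.
  + by rewrite subUset !sub1set uX vX.
  + by rewrite disjoints_subset subUset !sub1set !inE uM vM.
have [M maxM] := max_matching_exists X.
have /andP[/andP[mM MX] /eqP cM] := maxM.
(* Vertices missed by the same maximum matching lie in distinct classes. *)
have : (#|X :\: cover M| <= #|P|)%N.
  have injP : {in X :\: cover M &, injective (pblock P)}.
    move=> u v; rewrite !inE => /andP[uM uX] /andP[vM vX] uv.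
    have : v \in pblock P u by rewrite uv mem_pblock covP.
    rewrite pblock_equivalence_partition // => /orP[/eqP//|/negP[]].
    by apply/existsP; exists M; rewrite maxM uM vM.
  rewrite -(card_in_imset injP); apply: subset_leq_card.
  apply/subsetP => _ /imsetP[u uX ->]; apply: pblock_mem.
  by rewrite covP; move: uX; rewrite inE => /andP[].
rewrite cardsD (finset.setIidPr MX) card_cover_matching // cM cards0.
by rewrite leq_subLR add0n mulnC addnC.
Qed.

(** * Fractional matchings *)

Lemma matching_number_inT {G : sgraph} : matching_number_in [set: G] = matching_number G.
Proof. by apply: eq_bigl => M; rewrite /matching_in subsetT andbT. Qed.

(** The cut around an end of an edge is positive, and [edge_cut_le] bounds it by a multiple of the
    largest eigenvalue. *)
Lemma max_eigenvalue_gt0 {R : realType} {G : sgraph} :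
  edges G != finset.set0 -> 0 < laplacian_eigenvalue R G #|G|.
Proof.
move=> /set0Pn[_ /edgesP[u [v [uv _]]]].
have n0 : (0 : R) < #|G|%:R by rewrite ltr0n; apply/card_gt0P; exists u.
have := @edge_cut_le R G [set u]; rewrite cards1 mul1r => le.
have cut0 : 0 < edge_cut R [set u].
  rewrite /edge_cut (bigD1 u) //= (bigD1 v) //= !inE eqxx uv /=.
  have -> : v != u by apply: contraTneq uv => ->; rewrite adj_irr.
  rewrite -addrA ltr_wpDr ?ltr01 //.
  by rewrite addr_ge0 // ?sumr_ge0 // => w _; rewrite ?sumr_ge0.
have := lt_le_trans (mulr_gt0 n0 cut0) le; rewrite pmulr_lgt0 // subr_gt0 ltr1n.
rewrite (cardD1 u) (cardD1 v) !inE /=.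
by have -> : v != u by apply: contraTneq uv => ->; rewrite adj_irr.
Qed.

Lemma le_fractional_matching_number {R : realType} {G : sgraph} (f : {set G} -> R) :
  @fractional_matching R G f ->
  \sum_(e in edges G) f e <= fractional_matching_number R G.
Proof.
move=> ff; apply: ub_le_sup; last by exists f.
exists #|edges G|%:R => _ [g [g01 _] <-].
by rewrite -sumr_const; apply: ler_sum => e /g01/andP[].
Qed.

(** The bound [f e <= 1] follows from the constraint at an end of [e]. *)
Lemma fractional_matching_ge0 {R : realType} {G : sgraph} (f : {set G} -> R) :
  {in edges G, forall e, 0 <= f e} ->
  (forall x : G, \sum_(e in edges G | x \in e) f e <= 1) ->
  @fractional_matching R G f.
Proof.
move=> f0 f1; split=> // e eE; rewrite f0 //=.
have /edgesP[x [y [_ ee]]] := eE.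
apply: le_trans (f1 x); rewrite (bigD1 e) ?eE ?ee ?inE ?eqxx //= lerDl.
by apply: sumr_ge0 => g /andP[/andP[gE _] _]; exact: f0.
Qed.

Lemma sum_matching_at {R : realType} {G : sgraph} (M : {set {set G}}) (x : G) :
  is_matching M ->
  \sum_(e in edges G | x \in e) (e \in M)%:R = (x \in cover M)%:R :> R.
Proof.
move=> mM; have /andP[/subsetP ME _] := mM.
have [/bigcupP[e eM xe]|xM] := boolP (x \in cover M).
  rewrite (bigD1 e) ?ME ?xe //= eM big1 ?addr0 // => f /andP[/andP[_ xf] fe].
  case fM: (f \in M) => //; case/eqP: fe.
  exact: matching_same mM fM eM xf xe.
rewrite big1 // => f /andP[_ xf]; case fM: (f \in M) => //.
by case/negP: xM; apply/bigcupP; exists f.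
Qed.

Lemma sum_matching {R : realType} {G : sgraph} (M : {set {set G}}) :
  is_matching M -> \sum_(e in edges G) (e \in M)%:R = #|M|%:R :> R.
Proof.
move=> /andP[/subsetP ME _]; rewrite -natr_sum -big_mkcondr -sum1_card.
congr _%:R; apply: eq_bigl => e /=; rewrite andbC.
by case eM: (e \in M) => //=; rewrite ME.
Qed.

Lemma matching_number_le_fractional {R : realType} {G : sgraph} :
  (matching_number G)%:R <= fractional_matching_number R G.
Proof.
have [M /andP[/andP[mM _] /eqP cM]] := max_matching_exists [set: G].
rewrite -matching_number_inT -cM -(@sum_matching R) //.
apply: le_fractional_matching_number; apply: fractional_matching_ge0 => // x.
by rewrite sum_matching_at // lern1 leq_b1.
Qed.

(* The average over [v] of the near-perfect matchings missing [v], scaled so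
   that every vertex receives total weight 1. *)
Lemma fractional_factor_critical {R : realType} {G : sgraph} :
  (1 < #|G|)%N -> #|G| = (2 * matching_number G).+1 ->
  (forall v, missable [set: G] v) ->
  #|G|%:R / 2%:R <= fractional_matching_number R G.
Proof.
move=> n1 nE miss.
pose M v := xchoose (existsP (miss v)).
have MP v : max_matching [set: G] (M v) && (v \notin cover (M v)).
  exact: (xchooseP (existsP (miss v))).
have mM v : is_matching (M v) by case/andP: (MP v) => /andP[/andP[]].
have cM v : #|M v| = matching_number G.
  by case/andP: (MP v) => /andP[_ /eqP-> _]; exact: matching_number_inT.
have covM v x : (x \in cover (M v)) = (x != v).
  suff -> : cover (M v) = [set~ v] by rewrite !inE.
  apply/eqP; rewrite eqEcard card_cover_matching // cM cardsC1 nE /= mulnC leqnn andbT.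
  by rewrite subsetC sub1set inE; case/andP: (MP v).
have k0 : (0 : R) < #|G|.-1%:R by rewrite ltr0n -ltnS prednK // ltnW.
(* A vertex [x] is covered by [M v] exactly for the [#|G|.-1] vertices [v] other than [x]. The total
   weight is [#|G| * matching_number G / #|G|.-1], which is half of [#|G|]. *)
pose f e : R := (\sum_v (e \in M v)%:R) / #|G|.-1%:R.
have ff : @fractional_matching R G f.
  apply: fractional_matching_ge0 => [e _|x].
    by apply: divr_ge0; [exact: sumr_ge0|exact: ltW].
  rewrite -mulr_suml exchange_big /= ler_pdivrMr // mul1r.
  under eq_bigr => v _ do rewrite sum_matching_at // covM.
  rewrite -natr_sum ler_nat -(cardC1 x) -sum1_card [leqRHS]big_mkcond /=.
  by apply: leq_sum => v _; rewrite !inE eq_sym; case: (_ != _).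
apply: le_trans (le_fractional_matching_number _ ff).
rewrite -mulr_suml exchange_big /=.
under eq_bigr => v _ do rewrite sum_matching // cM.
rewrite sumr_const ler_pdivlMr // -[_ *+ _]mulr_natl.
by rewrite {2}nE /= natrM le_eqVlt; apply/orP; left; apply/eqP; field.
Qed.

Theorem theorem3p21 (R : realType) (G : sgraph) (r : R) :
  edges G != finset.set0 -> 0 < r -> r <= 1 / 2%:R ->
  (r * laplacian_eigenvalue R G #|G| <= laplacian_eigenvalue R G 2 ->
     r * #|G|%:R <= fractional_matching_number R G) /\
  (r * laplacian_eigenvalue R G #|G| <= laplacian_eigenvalue R G 2 ->
     (matching_number G)%:R <> 1 / 2%:R * (#|G|%:R - 1) :> R ->
     r * #|G|%:R <= (matching_number G)%:R).
Proof.
move=> E0 r0 r12; have mun0 := @max_eigenvalue_gt0 R G E0.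
set nu := matching_number G.
have nun : (2 * nu <= #|G|)%N.
  have [M /andP[/andP[mM _] /eqP cM]] := max_matching_exists [set: G].
  by rewrite mulnC /nu -matching_number_inT -cM -card_cover_matching // max_card.
have rn : r * #|G|%:R <= #|G|%:R / 2%:R.
  by rewrite mulrC ler_wpM2l // -[_^-1]mul1r.
(* Here [d] is the deficiency [#|G| - 2 * nu], so [n - d] is [2 * nu]. *)
have bound S P : has_barrier [set: G] S P -> (1 < #|P|)%N -> (2 * nu < #|G|)%N ->
    r * laplacian_eigenvalue R G #|G| <= laplacian_eigenvalue R G 2 ->
    r * #|G|%:R <= nu%:R.
  move=> [_ partP sepP le] P1 ltn rmu.
  rewrite setTD in partP; rewrite matching_number_inT cardsT -/nu in le.
  have := barrier_spectral_bound S P (#|G| - 2 * nu) r partP sepP P1.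
  rewrite subn_gt0 natrB // natrM => /(_ ltn _ r0 mun0 rmu) le2.
  have : 2 * (r * #|G|%:R) <= #|G|%:R - (#|G|%:R - 2 * nu%:R).
    by apply: le2; rewrite addnBA // leq_subLR [leqRHS]addnC.
  lra.
have main : r * laplacian_eigenvalue R G #|G| <= laplacian_eigenvalue R G 2 ->
    nu%:R <> 1 / 2%:R * (#|G|%:R - 1) :> R -> r * #|G|%:R <= nu%:R.
  move=> rmu nuN; case: (leqP #|G| (2 * nu)) => [le|lt].
    have : #|G|%:R <= 2 * nu%:R :> R by rewrite -natrM ler_nat.
    lra.
  (* Deficiency 1 is excluded by [nuN]; deficiency at least 2 forces two parts even when [S] is
     empty. *)
  have lt1 : ((2 * nu).+1 < #|G|)%N.
    rewrite ltn_neqAle lt andbT; apply/eqP => nE; apply: nuN.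
    have -> : #|G|%:R = 2 * nu%:R + 1 :> R by rewrite -nE -natrM natr1.
    by field.
  have [S [P SP]] := barrier_exists [set: G].
  apply: (bound S P) => //; case: SP => _ _ _.
  rewrite matching_number_inT cardsT -/nu; clear - lt1; lia.
split=> // rmu.
have [nuE|nuN] := pselect (nu%:R = 1 / 2%:R * (#|G|%:R - 1) :> R); last first.
  by apply: le_trans matching_number_le_fractional; exact: main.
have nE : #|G| = (2 * nu).+1.
  by apply/eqP; rewrite -(eqr_nat R) -natr1 natrM nuE; apply/eqP; field.
have n1 : (1 < #|G|)%N.
  by have /set0Pn[e eE] := E0; rewrite -(card_edge e eE) max_card.
have [/forallP miss|] := boolP [forall v, missable [set: G] v].
  by apply: le_trans rn _; exact: fractional_factor_critical.
rewrite negb_forall => /existsP[a na].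
apply: le_trans matching_number_le_fractional.
(* Every maximum matching covers [a], so a barrier of the rest extends by [a]; with [a |: S]
   nonempty, deficiency 1 already forces two parts. *)
have [S [P SP]] := barrier_exists ([set: G] :\ a).
have aS : a \notin S.
  by case: SP => /subsetP SX _ _ _; apply/negP => /SX; rewrite !inE eqxx.
have SP' : has_barrier [set: G] (a |: S) P by apply: has_barrier_setD1; rewrite ?inE.
apply: (bound _ _ SP') => //; last by rewrite nE.
case: SP' => _ _ _; rewrite cardsU1 aS matching_number_inT cardsT -/nu nE.
clear; lia.
Qed.
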